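(* Let $d$ be a positive integer, and let $D_4$ be the dihedral group of order $8$. Let $K$ be an abelian group of order $2^{2d-1}$ and exponent at most $4$. Then $G=D_4\times K$ contains a reduced linking system of difference sets of size $2^{d+1}-1$, that is, a reduced $\left(2^{2d+2},\,2^d(2^{d+1}-1),\,2^d(2^d-1),\,2^{2d};\,2^{d+1}-1\right)$-linking system of difference sets.
   Context: Groups are written multiplicatively and are not assumed abelian. For a group $G$ of order $v$, a subset $D\subseteq G$ with $k$ elements is a $(v,k,\lambda,n)$-difference set in $G$ if the multiset $\{d_1d_2^{-1} : d_1,d_2\in D,\ d_1\neq d_2\}$ contains every non-identity element of $G$ exactly $\lambda$ times, where $n:=k-\lambda$. A subset $S$ of $G$ is identified with the element $\sum_{s\in S}s$ of the group ring $\mathbb{Z}[G]$, and $S^{(-1)}:=\sum_{s\in S}s^{-1}$. For $\ell\ge 2$, a collection $\{D_1,\dots,D_\ell\}$ of size $\ell$ of $(v,k,\lambda,n)$-difference sets in $G$ is a reduced $(v,k,\lambda,n;\ell)$-linking system of difference sets in $G$ of size $\ell$ if there are integers $\mu,\nu$ such that for all distinct $i,j$ there is some $(v,k,\lambda,n)$-difference set $D(i,j)$ in $G$ (not necessarily one of the $D_r$) with $D_iD_j^{(-1)}=(\mu-\nu)D(i,j)+\nu G$ in $\mathbb{Z}[G]$. The exponent of a group $K$ is the smallest positive integer $\alpha$ with $g^\alpha=1_K$ for all $g\in K$. *)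

(* Defs.v *)
From HB Require Import structures.
From mathcomp Require Import all_boot all_order all_algebra all_fingroup.
From mathcomp Require Import all_solvable.

Set Implicit Arguments.
Unset Strict Implicit.
Unset Printing Implicit Defensive.

Import GRing.Theory.
Local Open Scope ring_scope.

(* The integral group ring Z[G], G being all of the (not necessarily abelian) *)
(* group type.  The alias blocks the pointwise product of {ffun G -> int}.    *)
Definition zgring (G : finGroupType) : Type := {ffun G -> int}.

Section GroupRing.
Variable G : finGroupType.
Implicit Types a b c : zgring G.

HB.instance Definition _ := GRing.Zmodule.copy (zgring G) {ffun G -> int}.

Definition zgcoef a (g : G) : int := (a : {ffun G -> int}) g.

Definition zgelt (g : G) : zgring G := [ffun h => (h == g)%:R : int].

Definition zgmul a b : zgring G :=
  [ffun g => \sum_(h : G) zgcoef a h * zgcoef b (h^-1 * g)%g].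

Lemma zgringP a b : (forall g, zgcoef a g = zgcoef b g) <-> a = b.
Proof. by split=> [ab|-> //]; apply/ffunP. Qed.

Lemma zgcoefD a b g : zgcoef (a + b) g = zgcoef a g + zgcoef b g.
Proof. by rewrite /zgcoef ffunE. Qed.

Lemma zgcoef_elt h g : zgcoef (zgelt h) g = (g == h)%:R.
Proof. by rewrite /zgcoef ffunE. Qed.

Lemma zgcoef_mul a b g :
  zgcoef (zgmul a b) g = \sum_h zgcoef a h * zgcoef b (h^-1 * g)%g.
Proof. by rewrite /zgcoef ffunE. Qed.

Lemma zgmulA : associative zgmul.
Proof.
move=> a b c; apply/zgringP => g; rewrite !zgcoef_mul.
under eq_bigr => h _ do rewrite zgcoef_mul big_distrr /=.
under [RHS]eq_bigr => h _ do rewrite zgcoef_mul big_distrl /=.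
rewrite exchange_big /= [RHS]exchange_big /= exchange_big /=.
apply: eq_bigr => h _; rewrite (reindex_inj (mulgI h^-1%g)) /=.
by apply: eq_bigr => x _; rewrite mulrA invMg invgK -mulgA mulKVg.
Qed.

Lemma zgmul1 : left_id (zgelt 1%g) zgmul.
Proof.
move=> a; apply/zgringP => g; rewrite zgcoef_mul (bigD1 1%g) //= big1.
  by rewrite zgcoef_elt eqxx mul1r addr0 invg1 mul1g.
by move=> h /negbTE nh; rewrite zgcoef_elt nh mul0r.
Qed.

Lemma zgmulr1 : right_id (zgelt 1%g) zgmul.
Proof.
move=> a; apply/zgringP => g; rewrite zgcoef_mul (bigD1 g) //= big1.
  by rewrite zgcoef_elt mulVg eqxx mulr1 addr0.
by move=> h nh; rewrite zgcoef_elt -eq_mulVg1 (negbTE nh) mulr0.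
Qed.

Lemma zgmulDl : left_distributive zgmul +%R.
Proof.
move=> a b c; apply/zgringP => g; rewrite zgcoefD !zgcoef_mul -big_split /=.
by apply: eq_bigr => h _; rewrite zgcoefD mulrDl.
Qed.

Lemma zgmulDr : right_distributive zgmul +%R.
Proof.
move=> a b c; apply/zgringP => g; rewrite zgcoefD !zgcoef_mul -big_split /=.
by apply: eq_bigr => h _; rewrite zgcoefD mulrDr.
Qed.

Lemma zgelt1_neq0 : zgelt 1%g != 0.
Proof.
apply/eqP=> /zgringP /(_ 1%g); rewrite zgcoef_elt eqxx.
by rewrite /zgcoef ffunE.
Qed.

HB.instance Definition _ := GRing.Zmodule_isNzRing.Build (zgring G)
  zgmulA zgmul1 zgmulr1 zgmulDl zgmulDr zgelt1_neq0.

Definition zgset (S : {set G}) : zgring G := \sum_(s in S) zgelt s.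

Definition zgset_inv (S : {set G}) : zgring G := \sum_(s in S) zgelt s^-1%g.

End GroupRing.

Section LinkingSystems.
Variable G : finGroupType.

Definition difference_set (v k lambda n : nat) (D : {set G}) : Prop :=
  [/\ #|[set: G]| = v,
      #|D| = k,
      forall g : G, g != 1%g ->
        #|[set p in setX D D | (p.1 != p.2) && (p.1 * p.2^-1 == g)%g]| = lambda
    & n%:Z = k%:Z - lambda%:Z].

(* The size l counts distinct difference sets, as F is a set of subsets of G. *)
Definition reduced_linking_system (v k lambda n l : nat)
    (F : {set {set G}}) : Prop :=
  [/\ (2 <= l)%N,
      #|F| = l,
      forall D, D \in F -> difference_set v k lambda n D
    & exists mu nu : int,
        forall Di Dj, Di \in F -> Dj \in F -> Di != Dj ->
          exists2 Dij : {set G}, difference_set v k lambda n Dij &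
            zgset Di * zgset_inv Dj
              = zgset Dij *~ (mu - nu) + zgset [set: G] *~ nu].

End LinkingSystems.

(* Main.v *)
Require Import Defs.
From mathcomp Require Import all_boot all_order all_algebra all_fingroup.
From mathcomp Require Import all_solvable all_field.
From mathcomp Require Import zify ring.

Set Implicit Arguments.
Unset Strict Implicit.
Unset Printing Implicit Defensive.

Import GRing.Theory Num.Theory.
Local Open Scope ring_scope.

(** The groups D_4 x K all have the following shape: the order of G is q ^ 2
    with q = 2 ^ (d + 1), and G has a central elementary abelian subgroup E of
    order q that contains every square of G.  Then E and G / E are both
    isomorphic to the additive group of the field L with q elements.  The
    linking system only depends on this structure.

    The elements k of L index the characters of E, with values 1 and -1, and
    hence the elements E_k = sum_(e in E) chi_k(e) e of the group ring.  These
    are central, fixed by inversion, and orthogonal: E_k E_l is q E_k if k = l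
    and 0 otherwise.  To a function s : L -> G attach the sum
      W_s = sum_k s(k) E_k.
    Orthogonality gives at once
      W_s W_t^(-1) = q W_(s t^-1),     W_s W_s^(-1) = q sum_k E_k = q ^ 2,
    where s t^-1 is the pointwise quotient (charsumM and charsumV).  If s meets
    each coset of E once, then at every g exactly one summand of W_s is nonzero
    and W_s has all its coefficients equal to 1 or -1, that is W_s = G - 2 D_s
    for the set D_s of those g with coefficient -1 (charsum_sign).  The second
    equation now says that D_s is a difference set with Hadamard parameters,
    and the first one that D_s D_t^(-1) is an integral combination of
    D_(s t^-1) and G, as soon as s t^-1 meets each coset of E once as well.

    Linked sets thus come from functions s whose pairwise quotients are still
    transversals, and the multiplication table of L provides q - 1 of them: for
    a nonzero in L, lift k |-> a k from G / E to G.  Modulo E the quotient of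
    the lifts for a and b is k |-> (a - b) k, which is bijective if a != b.  The
    lifts need not be homomorphisms: the elements of E that they introduce
    only change the signs of the terms of W_(s t^-1).

    It remains to find E in D_4 x K.  In D_4 the centre has order 2 and contains
    the squares.  In K the squares form a subgroup of the elements of order at
    most 2, since the exponent is at most 4; the product of the orders of these
    two groups is 2 ^ (2d - 1), so that some F between them has order 2 ^ d, and
    E = Z(D_4) x F. *)

(** * Coefficients, inversion and augmentation in the integral group ring *)

Section GroupRingCoefficients.
Variable G : finGroupType.
Implicit Types (a b : zgring G) (g h : G) (A B D : {set G}).

Lemma zgcoef0 g : zgcoef (0 : zgring G) g = 0.
Proof. by rewrite /zgcoef ffunE. Qed.

Lemma zgcoefN a g : zgcoef (- a) g = - zgcoef a g.
Proof. by rewrite /zgcoef ffunE. Qed.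

Lemma zgcoef_sum I (r : seq I) (P : pred I) (F : I -> zgring G) g :
  zgcoef (\sum_(i <- r | P i) F i) g = \sum_(i <- r | P i) zgcoef (F i) g.
Proof.
apply: (big_morph (fun a => zgcoef a g)) => [a b|]; first exact: zgcoefD.
exact: zgcoef0.
Qed.

Lemma zgcoefMn a n g : zgcoef (a *+ n) g = zgcoef a g *+ n.
Proof.
by elim: n => [|n IHn]; rewrite ?mulr0n ?zgcoef0 // !mulrS zgcoefD IHn.
Qed.

Lemma zgcoefMz a (n : int) g : zgcoef (a *~ n) g = zgcoef a g * n.
Proof.
case: n => n; first by rewrite -pmulrn zgcoefMn -mulr_natr natz.
by rewrite NegzE mulrNz zgcoefN -pmulrn zgcoefMn mulrN -mulr_natr natz.
Qed.

Lemma zgcoef_set A g : zgcoef (zgset A) g = (g \in A)%:R.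
Proof.
rewrite /zgset zgcoef_sum; under eq_bigr => s _ do rewrite zgcoef_elt.
have [Ag | Ag] := boolP (g \in A).
  rewrite (bigD1 g) //= eqxx big1 ?addr0 // => s /andP[_ /negbTE].
  by rewrite eq_sym => ->.
by rewrite big1 // => s As; case: eqP => // gs; rewrite gs As in Ag.
Qed.

Lemma zgcoef_eltM g a h : zgcoef (zgelt g * a) h = zgcoef a (g^-1 * h)%g.
Proof.
rewrite zgcoef_mul (bigD1 g) //= zgcoef_elt eqxx mul1r big1 ?addr0 // => x.
by move=> /negbTE ne; rewrite zgcoef_elt ne mul0r.
Qed.

Lemma zgcoef_Melt g a h : zgcoef (a * zgelt g) h = zgcoef a (h * g^-1)%g.
Proof.
rewrite zgcoef_mul (bigD1 (h * g^-1)%g) //= zgcoef_elt invMg invgK.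
rewrite mulgKV eqxx mulr1 big1 ?addr0 // => x ne.
rewrite zgcoef_elt; case: eqP => [e|]; last by rewrite mulr0.
by case/eqP: ne; rewrite -e invMg invgK mulKVg.
Qed.

(** The anti-automorphism written a^(-1) on the group ring; having it on all
    elements, and not only on subsets, is what allows computing with W_s. *)
Definition zginv a : zgring G := [ffun g => zgcoef a g^-1%g].

Lemma zgcoef_inv a g : zgcoef (zginv a) g = zgcoef a g^-1%g.
Proof. by rewrite /zgcoef ffunE. Qed.

Lemma zginvD a b : zginv (a + b) = zginv a + zginv b.
Proof. by apply/zgringP=> g; rewrite zgcoef_inv !zgcoefD !zgcoef_inv. Qed.

Lemma zginv_sum I (r : seq I) (P : pred I) (F : I -> zgring G) :
  zginv (\sum_(i <- r | P i) F i) = \sum_(i <- r | P i) zginv (F i).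
Proof.
apply: (big_morph zginv); first exact: zginvD.
by apply/zgringP=> g; rewrite zgcoef_inv !zgcoef0.
Qed.

Lemma zginvM a b : zginv (a * b) = zginv b * zginv a.
Proof.
apply/zgringP=> g; rewrite zgcoef_inv !zgcoef_mul.
rewrite (reindex_inj (mulgI g^-1%g)) /=; apply: eq_bigr => x _.
by rewrite !zgcoef_inv !invMg !invgK mulgK mulrC.
Qed.

Lemma zginv_elt g : zginv (zgelt g) = zgelt g^-1%g.
Proof.
by apply/zgringP=> h; rewrite zgcoef_inv !zgcoef_elt (can2_eq invgK invgK).
Qed.

Lemma zginv_set A : zginv (zgset A) = zgset_inv A.
Proof. by rewrite zginv_sum; apply: eq_bigr => s _; apply: zginv_elt. Qed.

Lemma zgcoef_setM_inv A B g :
  zgcoef (zgset A * zgset_inv B) g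
    = #|[set p in setX A B | (p.1 * p.2^-1 == g)%g]|%:R.
Proof.
rewrite -zginv_set zgcoef_mul.
have inj : injective (fun x : G => (x, g^-1 * x)%g) by move=> x y [].
have -> : [set p in setX A B | (p.1 * p.2^-1 == g)%g]
    = [set (x, g^-1 * x)%g | x in [set x in A | (g^-1 * x)%g \in B]].
  apply/setP=> [[x y]]; apply/idP/imsetP => [|[z]]; rewrite !inE /=.
    case/andP=> /andP[Ax By] /eqP <-.
    by exists x; rewrite ?inE invMg invgK mulgKV // Ax.
  by case/andP=> Az Bz [-> ->]; rewrite Az Bz invMg invgK mulKVg eqxx.
rewrite card_imset // -sum1_card natr_sum [RHS]big_mkcond /=.
apply: eq_bigr => x _; rewrite !zgcoef_inv !zgcoef_set invMg invgK inE.
by case: (x \in A); case: (_ \in B).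
Qed.

Lemma zgeltM g h : zgelt g * zgelt h = zgelt (g * h)%g.
Proof.
apply/zgringP=> x; rewrite zgcoef_eltM !zgcoef_elt.
by rewrite -(inj_eq (mulgI g)) mulKVg.
Qed.

Definition zgaug a : int := \sum_g zgcoef a g.

Lemma zgaug_set A : zgaug (zgset A) = #|A|%:R.
Proof.
rewrite /zgaug -sum1_card natr_sum [RHS]big_mkcond /=.
by apply: eq_bigr => g _; rewrite zgcoef_set; case: (g \in A).
Qed.

Lemma zgM_setT a : a * zgset setT = zgset setT *~ zgaug a.
Proof.
apply/zgringP=> g; rewrite zgcoef_mul zgcoefMz zgcoef_set inE mul1r.
by apply: eq_bigr => h _; rewrite zgcoef_set inE mulr1.
Qed.

Lemma zg_setTM a : zgset setT * a = zgset setT *~ zgaug a.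
Proof.
apply/zgringP=> g; rewrite zgcoef_mul zgcoefMz zgcoef_set inE mul1r.
rewrite [RHS](reindex_inj invg_inj) (reindex_inj (mulgI g)) /=.
by apply: eq_bigr => h _; rewrite zgcoef_set inE mul1r invMg mulgKV.
Qed.

Definition zgsign D : zgring G := zgset setT - zgset D *+ 2.

Lemma zgcoef_sign D g : zgcoef (zgsign D) g = if g \in D then -1 else 1.
Proof.
by rewrite zgcoefD zgcoefN zgcoefMn !zgcoef_set inE; case: (g \in D).
Qed.

Lemma zgaug_inv a : zgaug (zginv a) = zgaug a.
Proof.
rewrite /zgaug (reindex_inj invg_inj) /=.
by apply: eq_bigr => g _; rewrite zgcoef_inv invgK.
Qed.

Lemma zgaug_sign D : zgaug (zgsign D) = #|[set: G]|%:R - #|D|%:R *+ 2.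
Proof.
rewrite -!zgaug_set /zgaug -sumrMnl -sumrB.
by apply: eq_bigr => g _; rewrite zgcoefD zgcoefN zgcoefMn.
Qed.

(** Passing from 0/1 to 1/-1 coefficients changes the product A B^(-1) only by
    a factor 4 and a multiple of G, because G absorbs every factor up to its
    augmentation.  Identities between sign elements are thus identities between
    products of the underlying sets. *)
Lemma zgsignM A B :
  zgsign A * zginv (zgsign B)
    = zgset A * zgset_inv B *+ 4
      + zgset setT *~ (#|[set: G]|%:R - #|A|%:R *+ 2 - #|B|%:R *+ 2).
Proof.
have -> : zginv (zgsign B) = zgset setT - zgset_inv B *+ 2.
  apply/zgringP=> g; rewrite -zginv_set zgcoef_inv.
  by rewrite !(zgcoefD, zgcoefN, zgcoefMn) zgcoef_inv !zgcoef_set !inE.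
rewrite mulrBr zgM_setT zgaug_sign mulrBl -zginv_set mulrnAr zg_setTM.
rewrite mulrnAl mulrnAr zgaug_inv zgaug_set.
apply/zgringP=> g; rewrite !(zgcoefD, zgcoefN, zgcoefMn, zgcoefMz).
by rewrite zgcoef_set inE; ring.
Qed.

Lemma difference_set_of_coef (k lam n : nat) D :
    #|D| = k -> n%:Z = k%:Z - lam%:Z ->
    (forall g, g != 1%g -> zgcoef (zgset D * zgset_inv D) g = lam%:R) ->
  difference_set #|[set: G]| k lam n D.
Proof.
move=> cD nE DD; split=> // g ng1; move: (DD g ng1).
rewrite zgcoef_setM_inv => /eqP; rewrite eqr_nat => /eqP <-.
apply: eq_card => p; rewrite !inE; congr (_ && _).
case: eqP => [-> | //]; by rewrite mulgV eq_sym (negbTE ng1) andbF.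
Qed.

End GroupRingCoefficients.

(** * Character sums over a central elementary abelian subgroup *)

(** In this section f identifies E with the additive group of L, while h has
    kernel E and identifies G / E with a subgroup of the same additive group.
    The map T is a nontrivial sign character of (L, +); every character of E is
    then e |-> T (k * f e) for exactly one k in L. *)
Section CharacterSums.

Variables (G : finGroupType) (L : finFieldType) (E : {group G}).
Variables (T : L -> int) (f h : G -> L).

Hypothesis centE : E \subset 'Z([set: G])%g.
Hypothesis T_add : {morph T : x y / x + y >-> x * y}.
Hypothesis T_sign : forall x, T x = 1 \/ T x = -1.
Hypothesis T_neq1 : exists t, T t = -1.
Hypothesis f_morph : {in E &, {morph f : x y / (x * y)%g >-> x + y}}.
Hypothesis f_inj : {in E &, injective f}.
Hypothesis f_im : f @: E = setT.
Hypothesis h_morph : {morph h : x y / (x * y)%g >-> x + y}.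
Hypothesis h_ker : forall x, (h x == 0) = (x \in E).

Let T0 : T 0 = 1.
Proof. by have := T_add 0 0; rewrite addr0; case: (T_sign 0) => ->. Qed.

Let TN x : T (- x) = T x.
Proof.
have := T_add x (- x); rewrite subrr T0.
by case: (T_sign x) => ->; case: (T_sign (- x)) => ->.
Qed.

Let sum_T k : \sum_x T (k * x) = if k == 0 then #|L|%:R else 0.
Proof.
have [-> | nk] := eqVneq k 0.
  under eq_bigr => x _ do rewrite mul0r T0.
  by rewrite sumr_const.
have [t Tt] := T_neq1.
(* Translating x by t / k multiplies every term by T t = -1. *)
suff : \sum_x T (k * x) = - \sum_x T (k * x) by lia.
rewrite {1}(reindex_inj (addIr (t / k))) /= -sumrN.
apply: eq_bigr => x _; rewrite mulrDr T_add (mulrC t) mulVKf // Tt; ring.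
Qed.

Let sum_TE k : \sum_(e in E) T (k * f e) = if k == 0 then #|L|%:R else 0.
Proof.
rewrite -sum_T -(big_imset (fun x => T (k * x)) f_inj) /= f_im.
by apply: eq_bigl => x; rewrite inE.
Qed.

Let centEP e g : e \in E -> commute e g.
Proof.
by move=> Ee; have /centerP[_ /(_ g)] := subsetP centE e Ee; apply; rewrite inE.
Qed.

Let f1 : f 1%g = 0.
Proof.
have := f_morph (group1 E) (group1 E); rewrite mulg1 => /eqP.
by rewrite -subr_eq0 opprD addNKr oppr_eq0 => /eqP.
Qed.

Let fV e : e \in E -> f e^-1%g = - f e.
Proof.
move=> Ee; apply/eqP; rewrite -addr_eq0 -f_morph ?groupV //.
by rewrite mulVg f1.
Qed.

Let hV x : h x^-1%g = - h x.
Proof. by apply/eqP; rewrite -addr_eq0 -h_morph mulVg h_ker group1. Qed.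

Definition charE k : zgring G := [ffun g => if g \in E then T (k * f g) else 0].

Lemma zgcoef_charE k g :
  zgcoef (charE k) g = if g \in E then T (k * f g) else 0.
Proof. by rewrite /zgcoef ffunE. Qed.

(** The coefficient of the product at g in E is chi_l(g) times the sum over E of
    the character chi_(k - l), which vanishes unless k = l. *)
Lemma charE_orthogonal k l :
  charE k * charE l = if k == l then charE k *+ #|L| else 0.
Proof.
apply/zgringP=> g; rewrite zgcoef_mul.
transitivity (if g \in E then
    T (l * f g) * \sum_(e in E) T ((k - l) * f e) else 0).
  have [Eg | nEg] := boolP (g \in E).
    rewrite mulr_sumr [RHS]big_mkcond /=; apply: eq_bigr => e _.
    rewrite !zgcoef_charE.
    have [Ee | _] := boolP (e \in E); last by rewrite mul0r.
    rewrite groupM ?groupV // f_morph ?groupV // fV // -!T_add; congr T; ring.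
  apply: big1 => e _; rewrite !zgcoef_charE.
  have [Ee | _] := boolP (e \in E); last by rewrite mul0r.
  by rewrite groupMl ?groupV // (negbTE nEg) mulr0.
rewrite sum_TE subr_eq0; have [-> | _] := eqVneq k l.
  rewrite zgcoefMn zgcoef_charE; case: (g \in E); last by rewrite mul0rn.
  by rewrite mulr_natr.
by rewrite zgcoef0; case: ifP; rewrite ?mulr0.
Qed.

Lemma charE_central g k : zgelt g * charE k = charE k * zgelt g.
Proof.
apply/zgringP=> x; rewrite zgcoef_eltM zgcoef_Melt !zgcoef_charE.
have [Eu | nEu] := boolP ((g^-1 * x)%g \in E).
  have e : (x * g^-1 = g^-1 * x)%g.
    by have := centEP g Eu; rewrite /commute mulKVg => {1}<-; rewrite mulgK.
  by rewrite e Eu.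
have [Ew | //] := boolP ((x * g^-1)%g \in E).
case/negP: nEu; suff -> : (g^-1 * x = x * g^-1)%g by [].
by have := centEP g Ew; rewrite /commute mulgKV => {1}->; rewrite mulKg.
Qed.

Lemma charE_inv k : zginv (charE k) = charE k.
Proof.
apply/zgringP=> g; rewrite zgcoef_inv !zgcoef_charE groupV.
by case: ifP => // Eg; rewrite fV // mulrN TN.
Qed.

(** Dual orthogonality: at e in E the sum over k is that of T (k * f e), which
    vanishes unless f e = 0. *)
Lemma sum_charE : \sum_k charE k = 1 *+ #|L|.
Proof.
apply/zgringP=> g; rewrite zgcoef_sum zgcoefMn zgcoef_elt.
under eq_bigr => k _ do rewrite zgcoef_charE.
have [Eg | nEg] := boolP (g \in E); last first.
  rewrite big1 // (_ : (g == 1%g) = false) ?mul0rn //.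
  by apply: contraNF nEg => /eqP->.
under eq_bigr => k _ do rewrite mulrC.
rewrite sum_T -f1 (inj_in_eq f_inj) //.
by case: ifP; rewrite ?mul0rn.
Qed.

Definition charsum (s : L -> G) : zgring G := \sum_k zgelt (s k) * charE k.

(** As the E_k are central, W_s W_t^(-1) is the sum over k and l of
    s(k) t(l)^-1 E_k E_l, and only the terms with k = l survive. *)
Lemma charsumM s t :
  charsum s * zginv (charsum t) = charsum (fun k => s k * (t k)^-1)%g *+ #|L|.
Proof.
rewrite zginv_sum mulr_suml -sumrMnl; apply: eq_bigr => k _.
rewrite mulr_sumr (bigD1 k) //= big1 ?addr0 => [|l nlk].
  rewrite zginvM charE_inv zginv_elt -mulrA [charE k * _]mulrA.
  by rewrite charE_orthogonal eqxx mulrnAl mulrnAr -charE_central mulrA zgeltM.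
rewrite zginvM charE_inv -mulrA [charE k * _]mulrA charE_orthogonal.
by rewrite eq_sym (negbTE nlk) mul0r mulr0.
Qed.

Lemma charsum1 : charsum (fun=> 1%g) = 1 *+ #|L|.
Proof. by rewrite -sum_charE; apply: eq_bigr => k _; rewrite mul1r. Qed.

Lemma charsumV s : charsum s * zginv (charsum s) = 1 *+ (#|L| ^ 2).
Proof.
rewrite charsumM expnS expn1 mulrnA -charsum1; congr (_ *+ _).
by apply: eq_bigr => k _; rewrite mulgV.
Qed.

(** Only the trivial character k = 0 has a nonzero sum over its coset.  This
    determines the size of the set where the coefficient is -1. *)
Lemma zgaug_charsum s : zgaug (charsum s) = #|L|%:R.
Proof.
rewrite /zgaug; under eq_bigr => g _ do rewrite zgcoef_sum.
rewrite exchange_big /=.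
have coset_sum k :
    \sum_g zgcoef (zgelt (s k) * charE k) g = if k == 0 then #|L|%:R else 0.
  rewrite (reindex_inj (mulgI (s k))) /= -sum_TE [RHS]big_mkcond /=.
  by apply: eq_bigr => g _; rewrite zgcoef_eltM mulKg zgcoef_charE.
under eq_bigr => k _ do rewrite coset_sum.
by rewrite -big_mkcond big_pred1_eq.
Qed.

Definition negset s : {set G} := [set g | zgcoef (charsum s) g == -1].

(** Injectivity of h \o s makes it bijective on the finite set L, so that
    exactly one k has s(k) in the coset of g; only that summand contributes
    at g, by the value of a character. *)
Lemma charsum_sign s : injective (h \o s) -> charsum s = zgsign (negset s).
Proof.
move=> inj; apply/zgringP=> g; rewrite zgcoef_sign inE.
suff [-> | ->] : zgcoef (charsum s) g = 1 \/ zgcoef (charsum s) g = -1 by [].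
have [r _ rK] := injF_bij inj; pose k := r (h g).
rewrite zgcoef_sum (bigD1 k) //= big1 ?addr0 => [|l nlk].
  rewrite zgcoef_eltM zgcoef_charE -h_ker h_morph.
  by rewrite hV [h (s k)](rK (h g)) addNr eqxx.
rewrite zgcoef_eltM zgcoef_charE -h_ker h_morph.
rewrite hV addrC subr_eq0; case: eqP => // e; case/eqP: nlk.
by apply: inj; rewrite /= [h (s k)](rK (h g)).
Qed.

(** * Hadamard difference sets and their linking *)

Section HadamardSets.

Variable m : nat.
Hypothesis cL : #|L| = (2 * m)%N.
Hypothesis cG : #|[set: G]| = (#|L| ^ 2)%N.

Lemma card_negset s : injective (h \o s) -> #|negset s| = (m * (2 * m - 1))%N.
Proof.
move=> inj; have := zgaug_charsum s.
rewrite (charsum_sign inj) zgaug_sign cG cL; nia.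
Qed.

(** W_s W_s^(-1) is a multiple of 1, so its coefficients off the identity
    vanish; by zgsignM this fixes the number of representations there. *)
Lemma negset_difference_set s : injective (h \o s) ->
  difference_set #|[set: G]| (m * (2 * m - 1)) (m * (m - 1)) (m ^ 2) (negset s).
Proof.
move=> inj; have cD := card_negset inj.
apply: difference_set_of_coef => // [|g ng1]; first nia.
have := charsumV s.
rewrite (charsum_sign inj) zgsignM => /(congr1 (fun a => zgcoef a g)).
rewrite zgcoefD !zgcoefMn zgcoefMz zgcoef_set zgcoef_elt inE (negbTE ng1).
rewrite cD cG cL; nia.
Qed.

(** Rewriting charsumM with zgsignM gives
      4 D_s D_t^(-1) = (4 m ^ 2 - 2 m) G - 4 m D_(s t^-1);
    m has to be even for the division by 4 to be possible. *)
Lemma negset_linking s t : ~~ odd m ->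
    injective (h \o s) -> injective (h \o t) ->
    injective (h \o (fun k => s k * (t k)^-1)%g) ->
  zgset (negset s) * zgset_inv (negset t)
    = zgset (negset (fun k => s k * (t k)^-1)%g) *~ - m%:Z
      + zgset [set: G] *~ (m ^ 2 - m./2)%:Z.
Proof.
move=> evm inj_s inj_t inj_st.
have := charsumM s t; rewrite (charsum_sign inj_s) (charsum_sign inj_t).
rewrite (charsum_sign inj_st) zgsignM => E4; apply/zgringP=> g.
move/(congr1 (fun a => zgcoef a g)): E4.
rewrite !zgcoefD !zgcoefMn !zgcoefMz zgcoef_sign !zgcoef_set inE.
rewrite !card_negset // cG cL.
have -> : m = (2 * m./2)%N by lia.
case: (g \in _); nia.
Qed.

Hypothesis h_surj : forall y, exists x, h x == y.

Definition lift_scaling (a k : L) : G := xchoose (h_surj (a * k)).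

Lemma h_lift_scaling a k : h (lift_scaling a k) = a * k.
Proof. exact/eqP/(xchooseP (h_surj (a * k))). Qed.

Lemma injective_lift_scaling a : a != 0 -> injective (h \o lift_scaling a).
Proof. by move=> na x y /=; rewrite !h_lift_scaling => /(mulfI na). Qed.

Lemma injective_lift_scaling_ratio a b : a != b ->
  injective (h \o (fun k => lift_scaling a k * (lift_scaling b k)^-1)%g).
Proof.
move=> nab x y /=; rewrite !h_morph !hV !h_lift_scaling -!mulrBl.
by apply: mulfI; rewrite subr_eq0.
Qed.

(** If a and b gave the same set, W_a W_b^(-1) would be both W_a W_a^(-1) =
    q ^ 2 and q times an element with coefficients 1 and -1; compare at the
    identity. *)
Lemma negset_lift_scaling_inj :
  {in [set~ 0] &, injective (fun a => negset (lift_scaling a))}.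
Proof.
move=> a b; rewrite !inE => na nb eqD; apply/eqP/negPn/negP => nab.
have := charsumM (lift_scaling a) (lift_scaling b).
rewrite (charsum_sign (injective_lift_scaling nb)) -eqD.
rewrite -(charsum_sign (injective_lift_scaling na)) charsumV.
rewrite (charsum_sign (injective_lift_scaling_ratio nab)).
move/(congr1 (fun x => zgcoef x 1%g)).
rewrite !zgcoefMn zgcoef_sign zgcoef_elt eqxx.
have : (1 < #|L|)%N by rewrite (cardD1 0) (cardD1 1) !inE oner_neq0.
by case: (_ \in _); nia.
Qed.

Theorem negset_linking_system : ~~ odd m ->
  reduced_linking_system #|[set: G]|
    (m * (2 * m - 1)) (m * (m - 1)) (m ^ 2) (2 * m - 1)
    [set negset (lift_scaling a) | a in [set~ 0]].
Proof.
move=> evm; have m_gt1 : (1 < m)%N.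
  have : (1 < #|L|)%N by rewrite (cardD1 0) (cardD1 1) !inE oner_neq0.
  by rewrite cL; lia.
split; first lia.
- rewrite card_in_imset; last exact: negset_lift_scaling_inj.
  by rewrite cardsC1 cL subn1.
- move=> _ /imsetP[a na ->]; apply: negset_difference_set.
  by apply: injective_lift_scaling; rewrite !inE in na.
exists ((m ^ 2 - m./2)%:Z - m%:Z), (m ^ 2 - m./2)%:Z.
move=> _ _ /imsetP[a na ->] /imsetP[b nb ->] nD; rewrite !inE in na nb.
have nab : a != b by apply: contraNneq nD => ->.
exists (negset (fun k => lift_scaling a k * (lift_scaling b k)^-1)%g).
  exact/negset_difference_set/injective_lift_scaling_ratio.
rewrite negset_linking //.
- by congr (_ *~ _ + _); ring.
- exact: injective_lift_scaling.
- exact: injective_lift_scaling.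
exact: injective_lift_scaling_ratio.
Qed.

End HadamardSets.

End CharacterSums.

(** * Groups whose squares lie in a central elementary abelian subgroup *)

(** The additive group is a 2-group, so it has a maximal subgroup M, of index
    2; the character is 1 on M and -1 on the other coset. *)
Lemma exists_additive_sign (L : finFieldType) : 2%N \in [pchar L] ->
  exists T : L -> int, [/\ {morph T : x y / x + y >-> x * y},
    forall x, T x = 1 \/ T x = -1 & exists t, T t = -1].
Proof.
move=> ch2; have L2 : (2.-abelem [set: L])%g := fin_ring_pchar_abelem ch2.
have pL := abelem_pgroup L2.
have [e1 | [M maxM _]] := maximal_exists (sub1G [set: L]).
  have : (1 < #|[set: L]|)%N.
    by rewrite cardsT (cardD1 0) (cardD1 1) !inE oner_neq0.
  by rewrite -e1 cards1.
have idx := p_maximal_index pL maxM.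
(* Both x and - y lie in the only coset other than M, hence x - - y is in M. *)
have notM x y : x \notin M -> y \notin M -> x + y \in M.
  move=> Mx My.
  have My' : (y^-1)%g \in [set: L] :\: M by rewrite !inE groupV My.
  have ML : M \subset [set: L] by rewrite subsetT.
  have xN : x \in [set: L] :\: M by rewrite !inE Mx.
  by move: xN; rewrite -(rcoset_index2 ML idx My') mem_rcoset invgK.
exists (fun x => if x \in M then 1 else -1); split.
- move=> x y; rewrite -FinRing.zmodMgE.
  have [Mx | Mx] := boolP (x \in M); first by rewrite groupMl // mul1r.
  have [My | My] := boolP (y \in M); first by rewrite groupMr // (negbTE Mx).
  by rewrite FinRing.zmodMgE notM.
- by move=> x; case: ifP; [left | right].
have /properP[_ [t _ Mt]] := maxgroupp maxM.
by exists t; rewrite (negbTE Mt).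
Qed.

Lemma abelem_additive_iso (gT : finGroupType) (A : {group gT})
    (L : finFieldType) :
  2%N \in [pchar L] -> (2.-abelem A)%g -> #|A| = #|L| ->
  exists f : gT -> L, [/\ {in A &, {morph f : x y / (x * y)%g >-> x + y}},
    {in A &, injective f} & f @: A = [set: L]].
Proof.
move=> ch2 abA cA.
have L2 : (2.-abelem [set: L])%g := fin_ring_pchar_abelem ch2.
have /isogP[f /injmP injf imf] : A \isog [set: L].
  by rewrite (isog_abelem_card _ abA) L2 cardsT cA eqxx.
exists f; split=> //; first by move=> x y Ax Ay; rewrite morphM.
by rewrite -imf morphimEdom.
Qed.

(** As the squares lie in E, the quotient G / E has exponent 2 and is therefore
    elementary abelian, so that both E and G / E are copies of the additive
    group of the field with 2 ^ (d + 1) elements. *)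
Theorem central_elementary_linking_system (G : finGroupType) (E : {group G})
    (d : nat) :
  (0 < d)%N -> E \subset 'Z([set: G])%g -> #|E| = (2 ^ (d + 1))%N ->
  #|[set: G]| = (2 ^ (2 * d + 2))%N -> {in E, forall e, e ^+ 2 = 1}%g ->
  (forall x : G, x ^+ 2 \in E)%g ->
  exists F : {set {set G}},
    reduced_linking_system
      (2 ^ (2 * d + 2)) (2 ^ d * (2 ^ (d + 1) - 1)) (2 ^ d * (2 ^ d - 1))
      (2 ^ (2 * d)) (2 ^ (d + 1) - 1) F.
Proof.
move=> d_gt0 cE oE oG E2 sqE.
have abE : (2.-abelem E)%g by apply/exponent2_abelem/exponentP.
have nsE : (E <| [set: G])%g := sub_center_normal cE.
have nE x : (x \in 'N(E))%g := subsetP (normal_norm nsE) x (in_setT x).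
have abQ : (2.-abelem ([set: G] / E))%g.
  apply/exponent2_abelem/exponentP=> _ /morphimP[x _ _ ->].
  by rewrite -morphX //= coset_id.
have oQ : #|([set: G] / E)%g| = (2 ^ (d + 1))%N.
  rewrite card_quotient ?normal_norm // -divgS ?subsetT // oG oE.
  rewrite -expnB //; last lia.
  by congr (2 ^ _)%N; lia.
have [L ch2 oL] := @pPrimePowerField 2 (d + 1) isT (ltn_addl d (ltnSn 0)).
have [T [T_add T_sign T_neq1]] := exists_additive_sign ch2.
have [f [fM f_inj f_im]] := abelem_additive_iso ch2 abE (etrans oE (esym oL)).
have [u [uM u_inj u_im]] := abelem_additive_iso ch2 abQ (etrans oQ (esym oL)).
pose h x := u (coset E x).
have Qx x : (coset E x \in [set: G] / E)%g by apply: mem_quotient; rewrite inE.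
have hM : {morph h : x y / (x * y)%g >-> x + y}.
  by move=> x y; rewrite /h -uM // -morphM.
have h_ker x : (h x == 0) = (x \in E).
  have <- : h 1%g = 0 by apply: (addrI (h 1%g)); rewrite -hM mulg1 addr0.
  rewrite /h (inj_in_eq u_inj) // morph1.
  by apply/eqP/idP => [/coset_idr-> // | /coset_id].
have h_surj y : exists x, h x == y.
  have : y \in u @: ([set: G] / E)%g by rewrite u_im inE.
  by case/imsetP=> _ /morphimP[x _ _ ->] ->; exists x.
have oL' : #|L| = (2 * 2 ^ d)%N by rewrite oL addn1 expnS.
have oG' : #|[set: G]| = (#|L| ^ 2)%N.
  by rewrite oG oL -expnM; congr (2 ^ _)%N; lia.
have evd : ~~ odd (2 ^ d) by rewrite oddX; case: (d) d_gt0.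
have := negset_linking_system cE T_add T_sign T_neq1 fM f_inj f_im hM h_ker
  oL' oG' h_surj evd.
rewrite oG -expnM (mulnC d 2) -oL' oL => Hlink.
by eexists; exact: Hlink.
Qed.

(** * The subgroup of D_4 x K *)

(** For order 8, the centre and the subgroup generated by the squares are both
    generated by the square of a rotation of order 4. *)
Lemma dihedral8_center :
  exists2 Z : {group 'D_8},
    Z \subset 'Z([set: 'D_8])%g /\ #|Z| = 2%N &
    (forall x : 'D_8, x ^+ 2 \in Z)%g.
Proof.
have isoD : [set: 'D_8]%G \isog [set: 'D_(2 ^ 3)]%G := isog_refl _.
have [[x y] gen _] := @generators_2dihedral _ _ 3%N isT isoD.
have [_ _ [_ defMho] _ [defZ oZ _ _ _]] :=
  @dihedral2_structure _ _ 3%N x y isT gen isoD.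
exists 'Z([set: 'D_8])%G => [|t]; first by [].
rewrite /= defZ -(defMho 1%N isT); apply: (@Mho_p_elt 1 _ _ 2); rewrite ?inE //.
have D2 : (2.-group [set: 'D_8])%g by rewrite /pgroup (@card_2dihedral 3%N).
by apply: mem_p_elt D2 _; rewrite inE.
Qed.

(** Squaring has image S (the squares) and kernel O (the elements with square
    1), so |O| |S| = |K|; exponent at most 4 means that S is contained in O,
    whence |S| <= 2 ^ d <= |O|, and a 2-group has subgroups of all intermediate
    orders. *)
Lemma abelian_exponent4_square_subgroup (d : nat) (K : finGroupType) :
  abelian [set: K] -> #|[set: K]| = (2 ^ (2 * d - 1))%N ->
  (exponent [set: K] <= 4)%N ->
  exists2 F : {group K}, #|F| = (2 ^ d)%N &
    {in F, forall x, x ^+ 2 = 1}%g /\ (forall x : K, x ^+ 2 \in F)%g.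
Proof.
move=> abK oK expK.
have pK : (2.-group [set: K])%g by rewrite /pgroup oK pnatX.
have exp4 (x : K) : (x ^+ 4 = 1)%g.
  have : (exponent [set: K] %| 2 ^ (2 * d - 1))%N by rewrite -oK exponent_dvdn.
  case/(dvdn_pfactor _ _ (isT : prime 2)) => k _ ek; move: expK; rewrite ek.
  rewrite (leq_exp2l _ 2) // => k2; apply/eqP; rewrite -order_dvdn.
  apply: dvdn_trans (dvdn_exponent (in_setT x)) _.
  by rewrite ek (dvdn_exp2l 2 k2).
pose O := 'Ohm_1([set: K])%G; pose S := 'Mho^1([set: K])%G.
have abO : abelian O := abelianS (Ohm_sub 1 _) abK.
have inO x : (x \in O) = (x ^+ 2 == 1)%g.
  by rewrite /O /= (OhmEabelian pK abO) !inE.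
have inS x : (x ^+ 2)%g \in S.
  by rewrite /S /= (MhoEabelian 1 pK abK); apply/imsetP; exists x; rewrite ?inE.
have SO : S \subset O.
  apply/subsetP=> y; rewrite /S /= (MhoEabelian 1 pK abK) => /imsetP[x _ ->].
  by rewrite inO -expgM exp4.
have pO : (2.-group O)%g := pgroupS (subsetT _) pK.
have pS : (2.-group S)%g := pgroupS (subsetT _) pK.
have [o oO] : exists o, #|O| = (2 ^ o)%N by have [o] := p_natP pO; exists o.
have [s oS] : exists s, #|S| = (2 ^ s)%N by have [s] := p_natP pS; exists s.
have os : (o + s = 2 * d - 1)%N.
  have := mul_card_Ohm_Mho_abelian 1 abK; rewrite oK -/O -/S.
  rewrite [#|_|]oO [#|'Mho^1(_)%g|]oS -expnD => /eqP.
  by rewrite eqn_exp2l // => /eqP.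
have so : (s <= o)%N by have := subset_leq_card SO; rewrite oO oS leq_exp2l.
have sd : (s <= d)%N by lia.
have nSO : (S <| O)%g by rewrite -sub_abelian_normal.
have oQ : #|(O / S)%g| = (2 ^ (o - s))%N.
  by rewrite card_quotient ?normal_norm // -divgS // oO oS -expnB.
have pQ : (2.-group (O / S))%g := quotient_pgroup _ pO.
(* F is the preimage in O of a subgroup Q of O / S of order 2 ^ (d - s). *)
have [|Q [sQ _ cQ]] :=
  @normal_pgroup 2 _ (d - s) (O / S)%G (O / S)%G pQ (normal_refl _).
  by rewrite oQ pfactorK //; lia.
have [F defF sSF sFO] := inv_quotientS nSO sQ.
exists F.
  rewrite -(Lagrange sSF) -card_quotient; last first.
    exact: subset_trans sFO (normal_norm nSO).
  by rewrite -defF cQ oS -expnD subnKC.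
split=> [x Fx | x]; last exact: (subsetP sSF).
by apply/eqP; rewrite -inO (subsetP sFO).
Qed.

Theorem corollary5p10 (d : nat) (K : finGroupType) :
  (0 < d)%N ->
  abelian [set: K] ->
  #|[set: K]| = (2 ^ (2 * d - 1))%N ->
  (exponent [set: K] <= 4)%N ->
  exists F : {set {set ('D_8 * K)%type}},
    reduced_linking_system
      (2 ^ (2 * d + 2)) (2 ^ d * (2 ^ (d + 1) - 1)) (2 ^ d * (2 ^ d - 1))
      (2 ^ (2 * d)) (2 ^ (d + 1) - 1) F.
Proof.
move=> d_gt0 abK oK expK.
have [Z [cZ oZ] sqZ] := dihedral8_center.
have [F oF [F2 sqF]] := abelian_exponent4_square_subgroup abK oK expK.
have Z2 : {in Z, forall z, z ^+ 2 = 1}%g.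
  by move=> z /order_dvdG; rewrite oZ order_dvdn => /eqP.
apply: (@central_elementary_linking_system _ (setX Z F)%G) => //.
- apply/subsetP=> -[z x]; rewrite inE /= => /andP[Zz Fx].
  apply/centerP; split=> [|[y t] _]; first by rewrite inE.
  have /centerP[_ zy] := subsetP cZ z Zz.
  by congr (_, _) => /=; [apply: zy | apply: (centsP abK)]; rewrite inE.
- by rewrite cardsX oZ oF expnD mulnC.
- rewrite cardsT card_prod -!cardsT oK (@card_2dihedral 3%N) // -expnD.
  by congr (2 ^ _)%N; lia.
- move=> [z x]; rewrite inE /= => /andP[Zz Fx].
  by congr (_, _) => /=; [apply: Z2 | apply: F2].
by move=> [z x]; rewrite inE /= sqZ sqF.
Qed.
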